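(* For $r,z\in(0,1)$, the double transform $K(r,z):=\sum_{n=0}^\infty(1-r)^n r\,\mathbb{E}z^{Q_n}$ satisfies $$K(r,z)=\frac{r z\,\kappa_0(z)}{z-(1-r)\nu(z)}-\frac{(1-r)(1-z)\nu(z)}{z-(1-r)\nu(z)}\cdot\frac{r\,\kappa_0(z_0(r))}{1-z_0(r)},$$ where $z_0(r)$ is the unique root in $(0,1)$ of the equation $z=(1-r)\nu(z)$ (and at $z=z_0(r)$, where the denominators vanish, the right-hand side is understood as its limit).
   Context: Consider an M/G/1 queue in which the arrival rate is resampled at every service completion. Service times are i.i.d. copies of a non-negative random variable $S$ with Laplace–Stieltjes transform $\sigma(\theta)=\mathbb{E}e^{-\theta S}$; the arrival rates are i.i.d. copies of a non-negative random variable $\Lambda$, independent of the service times. Let $N_n$ be the number of customers arriving during the $n$-th service time (conditionally on its arrival rate and service time, Poisson with mean equal to their product), so the $N_n$ are i.i.d. with probability generating function $$\nu(z):=\mathbb{E}z^{N_n}=\mathbb{E}\,\sigma\big(\Lambda(1-z)\big).$$ Let $Q_n$ be the number of customers present at the $n$-th service completion, with $Q_0$ having a given distribution on $\{0,1,2,\dots\}$ independent of the $N_n$; it satisfies $Q_{n+1}=(Q_n-1)^+ + N_{n+1}$ in distribution, with $Q_n$ and $N_{n+1}$ independent. Write $\kappa_n(z):=\mathbb{E}z^{Q_n}$, so $\kappa_0$ is the probability generating function of $Q_0$. *)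

(* Defs.v *)
From HB Require Import structures.
From mathcomp Require Import all_boot all_order all_algebra.
From mathcomp Require Import all_classical all_reals all_analysis.
Set Implicit Arguments.
Unset Strict Implicit.
Unset Printing Implicit Defensive.
Import Order.TTheory GRing.Theory Num.Theory.
Import numFieldNormedType.Exports.
Local Open Scope classical_set_scope.
Local Open Scope ring_scope.

Definition eq_dist d d' (T : measurableType d) (T' : measurableType d')
    (R : realType) (P : probability T R) (X Y : T -> T') : Prop :=
  forall A, measurable A -> P (X @^-1` A) = P (Y @^-1` A).

Definition independent d d1 d2 (T : measurableType d)
    (T1 : measurableType d1) (T2 : measurableType d2)
    (R : realType) (P : probability T R) (X : T -> T1) (Y : T -> T2) : Prop :=
  forall A B, measurable A -> measurable B ->
    P (X @^-1` A `&` Y @^-1` B) = (P (X @^-1` A) * P (Y @^-1` B))%E.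

(* The finite subfamilies of X are given by the duplicate-free sequences s of
   indices. *)
Definition mutually_independent d d' (I : eqType) (T : measurableType d)
    (T' : measurableType d') (R : realType) (P : probability T R)
    (X : I -> T -> T') : Prop :=
  forall (s : seq I) (A : I -> set T'), uniq s ->
    (forall i, measurable (A i)) ->
    P (\bigcap_(i in [set` s]) (X i @^-1` A i)) =
    (\prod_(i <- s) P (X i @^-1` A i))%E.

(* Conditionally on the service time S and the arrival rate L, the number N of
   arrivals is Poisson with mean L * S. The events of the sigma-algebra
   generated by (S, L) are the sets C' below. We use poisson_prob, which is the
   Dirac mass at 0 when the mean is 0, because poisson_pmf 0 k is 1 for all k;
   the second argument of poisson_prob is a dummy. *)
Definition poisson_given d (T : measurableType d) (R : realType)
    (P : probability T R) (S L : T -> R) (N : T -> nat) : Prop :=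
  forall (U : set nat) (C : set (R * R)), measurable C ->
    let C' := (fun w => (S w, L w)) @^-1` C in
    P (N @^-1` U `&` C') = (\int[P]_(w in C') poisson_prob (L w * S w) 0%N U)%E.

(* Laplace-Stieltjes transform *)
Definition LST d (T : measurableType d) (R : realType)
    (P : probability T R) (X : T -> R) (theta : R) : R :=
  fine ('E_P[fun w => (expR (- theta * X w))%R])%E.

Definition pgf d (T : measurableType d) (R : realType)
    (P : probability T R) (X : T -> nat) (z : R) : R :=
  fine ('E_P[fun w => (z ^+ X w)%R])%E.

Definition arrivals_pgf d (T : measurableType d) (R : realType)
    (P : probability T R) (S L : T -> R) (z : R) : R :=
  fine ('E_P[fun w => LST P S (L w * (1 - z))])%E.

Definition double_transform d (T : measurableType d) (R : realType)
    (P : probability T R) (Q : nat -> T -> nat) (r z : R) : \bar R :=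
  (\sum_(0 <= n <oo) ((1 - r) ^+ n * r * pgf P (Q n) z)%:E)%E.

Definition is_root_in01 (R : realType) (nu : R -> R) (r z : R) : Prop :=
  0 < z < 1 /\ z = (1 - r) * nu z.

Definition transform_rhs (R : realType) (nu kappa0 : R -> R) (r z0 z : R) : R :=
  r * z * kappa0 z / (z - (1 - r) * nu z)
  - (1 - r) * (1 - z) * nu z / (z - (1 - r) * nu z)
    * (r * kappa0 z0 / (1 - z0)).

(* Main.v *)
(* Since z E z^((Q-1)^+) = E z^Q - (1-z) P(Q=0), the transforms kappa_n satisfy
   z kappa_{n+1} = nu (kappa_n - (1-z) P(Q_n=0)). Averaging over n with the
   weights (1-r)^n r gives, with Pi the average of the P(Q_n=0),
     (z - (1-r) nu) K = r z kappa_0 - (1-r) (1-z) nu Pi,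
   and the root z0 of the left factor determines Pi.
   Existence and uniqueness of z0 and continuity of K follow from the fact that
   nu and K are nondecreasing with values in [0, 1] and lie below the chords
   joining a point of their graph to (1, 1). *)
Require Import Defs.
From HB Require Import structures.
From mathcomp Require Import all_boot all_order all_algebra.
From mathcomp Require Import all_classical all_reals all_analysis.
From mathcomp Require Import measurable_realfun.
From mathcomp Require Import ring lra.
Import Order.TTheory GRing.Theory Num.Theory.
Import numFieldNormedType.Exports.
Local Open Scope classical_set_scope.
Local Open Scope ring_scope.
Set Implicit Arguments.
Unset Strict Implicit.

(** * Integrals of functions of equally distributed or independent variables *)

Lemma ge0_integral_eq_dist (d d' : measure_display) (T : measurableType d)
    (T' : measurableType d') (R : realType) (P : probability T R)
    (X Y : {mfun T >-> T'}) (f : T' -> \bar R) :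
  eq_dist P X Y -> measurable_fun setT f -> (forall x, 0 <= f x)%E ->
  (\int[P]_w f (X w) = \int[P]_w f (Y w))%E.
Proof.
move=> XY mf f0.
transitivity (\int[distribution P X]_x f x)%E.
  by rewrite ge0_integral_distribution.
transitivity (\int[distribution P Y]_x f x)%E; last first.
  by rewrite ge0_integral_distribution.
by apply: eq_measure_integral => A mA _; exact: XY.
Qed.

(** Independence says that the joint law agrees with the product of the marginal laws on rectangles,
    hence everywhere; Tonelli then gives the iterated integral. *)
Lemma ge0_integral_independent (d d1 d2 : measure_display)
    (T : measurableType d) (T1 : measurableType d1) (T2 : measurableType d2)
    (R : realType) (P : probability T R)
    (X : {mfun T >-> T1}) (Y : {mfun T >-> T2}) (f : T1 * T2 -> \bar R) :
  independent P X Y -> measurable_fun setT f -> (forall x, 0 <= f x)%E ->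
  (\int[P]_w f (X w, Y w) = \int[P]_w \int[P]_w' f (X w, Y w'))%E.
Proof.
move=> XY mf f0.
have mXY : measurable_fun setT (fun w => (X w, Y w)).
  by apply: measurable_fun_pair.
pose XYf : {mfun T >-> (T1 * T2)%type} := mfun_Sub (mem_set mXY).
transitivity (\int[distribution P XYf]_z f z)%E.
  by rewrite ge0_integral_distribution.
transitivity (\int[distribution P X \x distribution P Y]_z f z)%E.
  apply: eq_measure_integral => A mA _; apply/esym.
  exact: product_measure_unique.
rewrite fubini_tonelli1// /fubini_F.
rewrite ge0_integral_distribution.
- apply: eq_integral => w _ /=.
  rewrite ge0_integral_distribution//.
  exact: measurableT_comp.
- exact: (measurable_fun_fubini_tonelli_F _ mf).
- by move=> y; exact: integral_ge0.
Qed.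

(** * Probability generating functions on [[0, 1]] *)

Section pgf_theory.
Context (d : measure_display) (T : measurableType d) (R : realType).
Variable P : probability T R.

Lemma measurable_exprn_comp (X : T -> nat) (z : R) : measurable_fun setT X ->
  measurable_fun setT (fun w => (z ^+ X w)%:E).
Proof.
move=> mX; apply/measurable_EFinP.
by apply: (measurableT_comp (f := fun k : nat => z ^+ k)).
Qed.

Lemma probability_integral_itv01 (f : T -> \bar R) : measurable_fun setT f ->
  (forall w, 0 <= f w <= 1)%E ->
  (0 <= \int[P]_w f w <= 1)%E.
Proof.
move=> mf f01; rewrite integral_ge0/=; last by move=> w _; case/andP: (f01 w).
apply: (@le_trans _ _ (\int[P]_w (cst 1 w)))%E.
  by apply: ge0_le_integral => // w _; case/andP: (f01 w).
by rewrite integral_cst// mul1e probability_le1.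
Qed.

Lemma pgf_bound (X : T -> nat) (z : R) :
  measurable_fun setT X -> 0 <= z <= 1 ->
  (0 <= \int[P]_w (z ^+ X w)%:E <= 1)%E.
Proof.
move=> mX /andP[z0 z1]; apply: probability_integral_itv01.
  exact: measurable_exprn_comp.
by move=> w; rewrite !lee_fin exprn_ge0//= exprn_ile1.
Qed.

Lemma pgfE (X : T -> nat) (z : R) :
  measurable_fun setT X -> 0 <= z <= 1 ->
  (pgf P X z)%:E = (\int[P]_w (z ^+ X w)%:E)%E.
Proof.
move=> mX z01; rewrite /pgf unlock fineK//.
case/andP: (pgf_bound mX z01) => i0 i1.
by rewrite ge0_fin_numE// (le_lt_trans i1)// ltry.
Qed.

Lemma eq_dist_pgf (X Y : {mfun T >-> nat}) (z : R) :
  eq_dist P X Y -> 0 <= z <= 1 -> pgf P X z = pgf P Y z.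
Proof.
move=> XY z01; apply: EFin_inj; rewrite !pgfE//.
apply: (ge0_integral_eq_dist XY (f := fun k => (z ^+ k)%:E)) => //.
by move=> k; rewrite lee_fin exprn_ge0//; case/andP: z01.
Qed.

(* Multiplying by [z] absorbs the truncation: [z * z ^+ (q - 1)] is [z ^+ q],
   except at [q = 0] where it is [z] instead of [1]. *)
Lemma pgf_pred_rec (Q : {mfun T >-> nat}) (z : R) : 0 <= z <= 1 ->
  z * pgf P (fun w => (Q w - 1)%N) z =
  pgf P Q z - (1 - z) * fine (P (Q @^-1` [set 0%N])).
Proof.
move=> z01; have /andP[z0 z1] := z01.
have mQ1 : measurable_fun setT (fun w => (Q w - 1)%N).
  by apply: (measurableT_comp (f := fun k : nat => (k - 1)%N)).
have mQ0 : measurable (Q @^-1` [set 0%N]).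
  by rewrite -[X in measurable X]setTI; exact: measurable_funP.
apply/esym/eqP; rewrite subr_eq; apply/eqP/EFin_inj.
rewrite EFinD !EFinM !pgfE// fineK ?fin_num_measure//.
have -> : P (Q @^-1` [set 0%N]) = (\int[P]_w (\1_(Q @^-1` [set 0%N]) w)%:E)%E.
  by rewrite integral_indic// setIT.
have mz : measurable_fun setT (fun w => (z ^+ (Q w - 1))%:E).
  exact: measurable_exprn_comp.
have mi : measurable_fun setT (fun w => (\1_(Q @^-1` [set 0%N]) w)%:E : \bar R).
  exact/measurable_EFinP/measurable_indic.
rewrite -ge0_integralZl_EFin//; last first.
  by move=> w _; rewrite lee_fin exprn_ge0.
rewrite -ge0_integralZl_EFin// ?subr_ge0//.
rewrite -ge0_integralD//; last 4 first.
- by move=> w _; rewrite -EFinM lee_fin mulr_ge0// exprn_ge0.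
- by apply: measurable_funeM.
- by move=> w _; rewrite -EFinM lee_fin mulr_ge0// subr_ge0.
- by apply: measurable_funeM.
apply: eq_integral => w _; rewrite -!EFinM -EFinD; congr (_%:E).
rewrite indicE /=; case Qw : (Q w) => [|k].
  by rewrite mem_set//= sub0n !expr0; ring.
by rewrite memNset /= ?Qw// mulr0n mulr0 addr0 subSS subn0 exprS.
Qed.

Lemma independent_pgfD (X Y : {mfun T >-> nat}) (z : R) :
  independent P X Y -> 0 <= z <= 1 ->
  pgf P (fun w => (X w + Y w)%N) z = pgf P X z * pgf P Y z.
Proof.
move=> XY z01; have /andP[z0 z1] := z01.
apply: EFin_inj; rewrite EFinM !pgfE//; last exact: measurable_fun_addn.
transitivity (\int[P]_w \int[P]_w' ((z ^+ X w)%:E * (z ^+ Y w')%:E))%E.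
  rewrite -(ge0_integral_independent XY
    (f := fun x => (z ^+ x.1)%:E * (z ^+ x.2)%:E)%E).
  - by under eq_integral do rewrite exprD EFinM.
  - apply: emeasurable_funM; apply/measurable_EFinP.
    + by apply: (measurableT_comp (f := fun k : nat => z ^+ k)).
    + by apply: (measurableT_comp (f := fun k : nat => z ^+ k)).
  - by move=> x; rewrite -EFinM lee_fin mulr_ge0// exprn_ge0.
have mX : measurable_fun setT (fun w => (z ^+ X w)%:E).
  exact: measurable_exprn_comp.
have mY : measurable_fun setT (fun w => (z ^+ Y w)%:E).
  exact: measurable_exprn_comp.
transitivity (\int[P]_w ((pgf P Y z)%:E * (z ^+ X w)%:E))%E.
  apply: eq_integral => w _; rewrite pgfE// muleC.
  rewrite -ge0_integralZl_EFin ?exprn_ge0//.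
  by move=> w' _; rewrite lee_fin exprn_ge0.
rewrite ge0_integralZl_EFin//.
- by rewrite pgfE// muleC.
- by move=> w _; rewrite lee_fin exprn_ge0.
- rewrite -lee_fin pgfE//.
  by case/andP: (pgf_bound (@measurable_funPT _ _ _ _ Y) z01).
Qed.

End pgf_theory.

(** * Generating functions of Poisson and mixed Poisson laws *)

Lemma nneseries_expR (R : realType) (x : R) : 0 <= x ->
  (\sum_(0 <= k <oo) (x ^+ k / k`!%:R)%:E = (expR x)%:E)%E.
Proof.
move=> x0; rewrite /expR -EFin_lim; last exact: is_cvg_series_exp_coeff.
by apply/congr_lim/funext => n /=; rewrite sumEFin.
Qed.

Lemma poisson_prob_set1 (R : realType) (m : R) (k : nat) :
  poisson_prob m 0%N [set k] =
  if 0 < m then (poisson_pmf m k)%:E else (k == 0%N)%:R%:E.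
Proof.
rewrite /poisson_prob; case: ifPn => m0.
  by rewrite esum_set1// lee_fin poisson_pmf_ge0.
rewrite diracE; congr (_%:R%:E); congr nat_of_bool.
by apply/idP/eqP => [/set_mem <-//|->]; rewrite mem_set.
Qed.

Lemma measurable_poisson_prob_set1 (R : realType) (k : nat) :
  measurable_fun setT (fun m : R => poisson_prob m 0%N [set k]).
Proof.
under eq_fun do rewrite poisson_prob_set1.
apply: measurable_fun_ifT => //.
- exact: measurable_fun_ltr.
- by apply/measurable_EFinP; exact: measurable_poisson_pmf.
Qed.

(* For [m < 0], [poisson_prob m] is the Dirac mass at 0, like for [m = 0]. *)
Lemma poisson_prob_pgf (R : realType) (m z : R) : 0 <= z ->
  (\sum_(0 <= k <oo) ((z ^+ k)%:E * poisson_prob m 0%N [set k]) =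
   (expR (- (Num.max m 0 * (1 - z))))%:E)%E.
Proof.
move=> z0; have [m0|m0] := ltP 0 m.
  under eq_eseriesr => k _.
    rewrite poisson_prob_set1 m0 /poisson_pmf m0 -EFinM.
    rewrite (_ : z ^+ k * _ = expR (- m) * ((z * m) ^+ k / k`!%:R)); last first.
      by rewrite exprMn; ring.
    rewrite EFinM.
    over.
  rewrite nneseriesZl; last first.
    by move=> k _; rewrite lee_fin divr_ge0// exprn_ge0// mulr_ge0// ltW.
  rewrite nneseries_expR; last by rewrite mulr_ge0// ltW.
  by rewrite -EFinM -expRD; congr (expR _)%:E; ring.
rewrite mul0r oppr0 expR0 (@nneseriesD1 _ _ 0%N)//; last first.
  move=> k _; rewrite poisson_prob_set1 ltNge m0/= -EFinM lee_fin.
  by rewrite mulr_ge0// exprn_ge0.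
rewrite eseries0 => [|k _ /= k0]; last first.
  by rewrite poisson_prob_set1 ltNge m0/= (negbTE k0) mule0.
by rewrite poisson_prob_set1 ltNge m0/= expr0 mul1e adde0.
Qed.

Section mixed_poisson.
Context (d : measure_display) (T : measurableType d) (R : realType).
Variable P : probability T R.

Lemma pgf_series (X : {mfun T >-> nat}) (z : R) : 0 <= z <= 1 ->
  (pgf P X z)%:E = (\sum_(0 <= k <oo) ((z ^+ k)%:E * P (X @^-1` [set k])))%E.
Proof.
move=> z01; have /andP[z0 _] := z01; rewrite pgfE//.
have mX k : measurable (X @^-1` [set k]).
  by rewrite -[X in measurable X]setTI; exact: measurable_funP.
have mi k : measurable_fun setT (fun w => (\1_(X @^-1` [set k]) w)%:E : \bar R).
  exact/measurable_EFinP/measurable_indic.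
under eq_eseriesr => k _.
  rewrite -[X @^-1` _]setIT -integral_indic// -ge0_integralZl_EFin ?exprn_ge0//.
  over.
rewrite -integral_nneseries//; first last.
- by move=> k w _; rewrite -EFinM lee_fin mulr_ge0// exprn_ge0.
- by move=> k; exact: measurable_funeM.
apply: eq_integral => w _.
(* Only the term [k = X w] of the series is nonzero. *)
rewrite (@nneseriesD1 _ _ (X w))//; last first.
  by move=> k _; rewrite -EFinM lee_fin mulr_ge0// exprn_ge0.
rewrite eseries0 => [|k _ /= k0]; last first.
  rewrite indicE memNset ?mule0//= => Xk.
  by rewrite Xk eqxx in k0.
by rewrite indicE mem_set//= mule1 adde0.
Qed.

(** Taking the whole plane for the conditioning event gives each [P (N = k)] as an integral of
    Poisson masses, and the sum over [k] goes under the integral. The maximum with 0 is there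
    because variables that are only copies of non-negative ones may be negative on a null set. *)
Lemma mixed_poisson_pgf (S L : {mfun T >-> R}) (N : {mfun T >-> nat}) (z : R) :
  poisson_given P S L N -> 0 <= z <= 1 ->
  (pgf P N z)%:E =
  (\int[P]_w (expR (- (Num.max (L w * S w) 0 * (1 - z))))%:E)%E.
Proof.
move=> NP z01; have /andP[z0 _] := z01; rewrite pgf_series//.
have mp k : measurable_fun setT (fun w => poisson_prob (L w * S w) 0%N [set k]).
  apply: (measurableT_comp (@measurable_poisson_prob_set1 R k)).
  exact: measurable_funM.
under eq_eseriesr => k _.
  rewrite -[N @^-1` _]setIT.
  have := NP [set k] setT measurableT; rewrite preimage_setT /= => ->.
  rewrite -ge0_integralZl_EFin ?exprn_ge0//.
  over.
rewrite -integral_nneseries//; first last.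
- by move=> k w _; rewrite mule_ge0// lee_fin exprn_ge0.
- by move=> k; exact: measurable_funeM.
by apply: eq_integral => w _; rewrite poisson_prob_pgf.
Qed.

End mixed_poisson.

(** * The number of arrivals during one service *)

Section arrivals.
Context (d : measure_display) (T : measurableType d) (R : realType).
Variable P : probability T R.

Lemma LSTE (S : {mfun T >-> R}) (theta : R) : (forall w, 0 <= S w) ->
  0 <= theta ->
  (LST P S theta)%:E = (\int[P]_w (expR (- theta * S w))%:E)%E.
Proof.
move=> S0 t0; rewrite /LST unlock fineK//.
have mS : measurable_fun setT (fun w => (expR (- theta * S w))%:E).
  apply/measurable_EFinP/measurableT_comp => //.
  exact: measurable_funM.
have /andP[i0 i1] : (0 <= \int[P]_w (expR (- theta * S w))%:E <= 1)%E.
  apply: probability_integral_itv01 => // w.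
  by rewrite !lee_fin expR_ge0 -expR0 ler_expR mulNr oppr_le0 mulr_ge0.
by rewrite ge0_fin_numE// (le_lt_trans i1)// ltry.
Qed.

(** Independence splits the mixed Poisson integral into an iterated one. There [S'] is replaced by
    [S] with the rate fixed, then [L'] by [L]. Since [S] and [L] are non-negative everywhere, the
    maximum with 0 disappears and the inner integral is the Laplace-Stieltjes transform. *)
Lemma pgf_arrivals (S L S' L' : {mfun T >-> R}) (N : {mfun T >-> nat}) (z : R) :
  (forall w, 0 <= S w) -> (forall w, 0 <= L w) ->
  eq_dist P S' S -> eq_dist P L' L -> independent P L' S' ->
  poisson_given P S' L' N -> 0 <= z <= 1 ->
  pgf P N z = arrivals_pgf P S L z.
Proof.
move=> S0 L0 SS LL LS NP z01; have /andP[z0 z1] := z01.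
pose f (x : R * R) : \bar R := (expR (- (Num.max (x.1 * x.2) 0 * (1 - z))))%:E.
have mf : measurable_fun setT f.
  apply/measurable_EFinP/measurableT_comp => //.
  apply: measurableT_comp => //; apply: measurable_funM => //.
  by apply: measurable_maxr => //; exact: measurable_funM.
have f0 x : (0 <= f x)%E by rewrite lee_fin expR_ge0.
have f1 x : (f x <= 1)%E.
  rewrite lee_fin -[leRHS]expR0 ler_expR oppr_le0 mulr_ge0 ?subr_ge0//.
  by rewrite le_max lexx orbT.
have mfS : measurable_fun setT (fun x => \int[P]_w f (x, S w))%E.
  apply: (@measurable_fun_fubini_tonelli_F _ _ _ _ _ P
    (fun xw => f (xw.1, S xw.2))) => //.
  apply: measurableT_comp => //; apply: measurable_fun_pair => //.
  exact: measurableT_comp.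
have E x : 0 <= x -> (LST P S (x * (1 - z)))%:E = (\int[P]_w f (x, S w))%E.
  move=> x0; rewrite LSTE//; last by rewrite mulr_ge0// subr_ge0.
  apply: eq_integral => w _; rewrite /f/=; congr (expR _)%:E.
  by rewrite max_l ?mulr_ge0//; ring.
apply: EFin_inj; rewrite (mixed_poisson_pgf NP)//.
rewrite (ge0_integral_independent LS mf)//.
under eq_integral => w _.
  rewrite (ge0_integral_eq_dist SS (f := fun y => f (L' w, y)))//; last first.
    by apply: measurableT_comp => //; exact: measurable_fun_pair.
  over.
rewrite (ge0_integral_eq_dist LL mfS); last first.
  by move=> x; apply: integral_ge0 => w _; exact: f0.
rewrite /arrivals_pgf unlock.
under [in RHS]eq_integral => w _ do rewrite E//.
rewrite fineK//.
have /andP[i0 i1] : (0 <= \int[P]_w \int[P]_w' f (L w, S w') <= 1)%E.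
  apply: probability_integral_itv01 => [|w]; first exact: (measurableT_comp mfS).
  apply: probability_integral_itv01 => [|w']; last by rewrite f0 f1.
  by apply: measurableT_comp => //; exact: measurable_fun_pair.
by rewrite ge0_fin_numE// (le_lt_trans i1)// ltry.
Qed.

(** The value is the integral of an exponential, which is positive everywhere. This positivity later
    keeps the root of [z = (1 - r) * nu z] away from 0. *)
Lemma mixed_poisson_pgf0_gt0 (S L : {mfun T >-> R}) (N : {mfun T >-> nat}) :
  poisson_given P S L N -> 0 < pgf P N 0.
Proof.
move=> NP; have z01 : 0 <= (0 : R) <= 1 by rewrite lexx ler01.
have mf : measurable_fun setT
    (fun w => (expR (- (Num.max (L w * S w) 0 * (1 - 0))))%:E : \bar R).
  apply/measurable_EFinP/measurableT_comp => //.
  apply: measurableT_comp => //; apply: measurable_funM => //.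
  by apply: measurable_maxr => //; exact: measurable_funM.
rewrite -lte_fin (mixed_poisson_pgf NP)// lt_def integral_ge0 ?andbT; last first.
  by move=> w _; rewrite lee_fin expR_ge0.
apply/eqP => I0.
(* A zero integral would make the integrand vanish almost everywhere; as it vanishes nowhere, the
   exceptional null set would be the whole space. *)
have [+ _] := ae_eq_integral_abs P measurableT mf.
under eq_integral do rewrite gee0_abs ?lee_fin ?expR_ge0//.
move=> /(_ I0) [A [mA PA0 sA]].
have := @probability_setT _ _ _ P.
rewrite (_ : setT = A) ?PA0; last first.
  apply/seteqP; split => // w _; apply: sA => /= /(_ Logic.I) [] /eqP.
  by rewrite gt_eqF// expR_gt0.
by move/eqP; rewrite eq_sym onee_eq0.
Qed.

End arrivals.

(** * The chord condition: continuity and the fixed-point equation *)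

(* The last clause says that [f] lies below the chord from [(a, f a)] to
   [(1, 1)]. It holds for mixtures of [z ^+ n] with total mass at most 1 and
   bounds the slope on [[0, c]] by [1 / (1 - c)]. *)
Definition pgf_like (R : realType) (f : R -> R) : Prop :=
  forall a b : R, 0 <= a -> a <= b -> b <= 1 ->
  [/\ 0 <= f a, f a <= f b, f b <= 1 &
      (1 - a) * f b <= (b - a) + (1 - b) * f a].

Section pgf_like.
Context (R : realType).
Implicit Types (f : R -> R).

Lemma pgf_like_exprn (n : nat) : pgf_like (fun z : R => z ^+ n).
Proof.
move=> a b a0 ab b1; have b0 := le_trans a0 ab; have a1 := le_trans ab b1.
split; [by rewrite exprn_ge0|by rewrite lerXn2r ?nnegrE|by rewrite exprn_ile1|].
elim: n => [|n ih]; first by rewrite !expr0; lra.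
have an1 : a ^+ n <= 1 by rewrite exprn_ile1.
(* The right-hand side of the induction hypothesis times [b] falls short of the required one by
   exactly [(1 - b) * (b - a) * (1 - a ^+ n)]. *)
have := ler_wpM2l b0 ih.
have : 0 <= (1 - b) * (b - a) * (1 - a ^+ n) by rewrite !mulr_ge0// subr_ge0.
rewrite !exprS; move: (a ^+ n) (b ^+ n) => x y *; lra.
Qed.

(** For [x <= y] the chord clause reads [(1 - x) * (f y - f x) <= (y - x) * (1 - f x)]; here
    [1 - f x <= 1] and [1 - c <= 1 - x]. *)
Lemma pgf_like_lipschitz f (c : R) : pgf_like f -> c < 1 ->
  forall x y, 0 <= x <= c -> 0 <= y <= c ->
  `|f x - f y| <= (1 - c)^-1 * `|x - y|.
Proof.
move=> fP c1; have c0 : 0 < 1 - c by rewrite subr_gt0.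
have H x y : 0 <= x -> x <= y -> y <= c ->
    `|f x - f y| <= (1 - c)^-1 * `|x - y|.
  move=> x0 xy yc.
  have [fx0 fxy fy1 fxyE] := fP x y x0 xy (le_trans yc (ltW c1)).
  rewrite ler_pdivlMl// (distrC (f x)) (distrC x) !ger0_norm ?subr_ge0//.
  have : (y - c) * (f y - f x) <= 0 by rewrite mulr_le0_ge0 ?subr_le0 ?subr_ge0.
  have : 0 <= (y - x) * f x by rewrite mulr_ge0 ?subr_ge0.
  have : 0 <= (y - x) * (f y - f x) by rewrite mulr_ge0 ?subr_ge0.
  lra.
move=> x y /andP[x0 xc] /andP[y0 yc].
have [xy|/ltW yx] := leP x y; first exact: H.
by rewrite distrC (distrC x) H.
Qed.

Lemma pgf_like_within_continuous f (c : R) : pgf_like f -> c < 1 ->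
  {within `[0, c], continuous f}.
Proof.
move=> fP c1; apply/subspace_continuousP => x /=; rewrite in_itv/= => x0c.
apply/cvgrPdist_le => e e0; rewrite near_withinE.
near=> y; rewrite /= in_itv/= => y0c.
apply: (le_trans (pgf_like_lipschitz fP c1 x0c y0c)).
rewrite ler_pdivrMl ?subr_gt0//.
near: y; apply: cvgr_dist_le => //; rewrite mulr_gt0// subr_gt0//.
Unshelve. all: by end_near. Qed.

Lemma pgf_like_continuous f (x : R) : pgf_like f -> 0 < x < 1 ->
  {for x, continuous f}.
Proof.
move=> fP /andP[x0 x1].
(* The midpoint of [x] and 1 serves as [c], so that [x] is interior to [[0, c]] while [c < 1]. *)
have c1 : (x + 1) / 2 < 1 by lra.
apply: (within_continuous_continuous _ (pgf_like_within_continuous fP c1)).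
  by lra.
by rewrite in_itv/=; apply/andP; split; lra.
Qed.

(** The function [z - (1 - r) * f z] is negative at 0 because [f 0 > 0], and non-negative at [1 - r]
    because [f <= 1]. Stopping at [1 - r] rather than 1 stays where continuity has been
    established. *)
Lemma pgf_like_root_exists f (r : R) : pgf_like f -> 0 < f 0 -> 0 < r < 1 ->
  exists z, is_root_in01 f r z.
Proof.
move=> fP f0 /andP[r0 r1].
have c1 : 1 - r < 1 by lra.
have [f0' f0r fr1 _] := fP 0 (1 - r) (lexx _) ltac:(lra) (ltW c1).
have cont : {within `[0, 1 - r], continuous (fun z => z - (1 - r) * f z)}.
  move=> x; apply: cvgB.
    exact: (continuous_subspaceT (fun y => @cvg_id _ (nbhs y))).
  by apply: cvgMl_tmp; exact: pgf_like_within_continuous.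
have [||z] := IVT (v := 0) _ cont; first by lra.
  rewrite ge_min le_max; apply/andP; split; apply/orP; [left|right]; nra.
rewrite in_itv/= => /andP[z0 zr] /eqP; rewrite subr_eq0 => /eqP zE.
exists z; split => //; apply/andP; split; last by lra.
rewrite lt_neqAle z0 andbT; apply/eqP => z00.
by move: zE; rewrite -z00; nra.
Qed.

(** For two roots [a < b], the chord clause times [1 - r] becomes, after substituting both
    equations, [b - a <= (1 - r) * (b - a)], which contradicts [r > 0]. *)
Lemma pgf_like_root_unique f (r x y : R) : pgf_like f -> 0 < r < 1 ->
  is_root_in01 f r x -> is_root_in01 f r y -> x = y.
Proof.
move=> fP r01.
have H a b : is_root_in01 f r a -> is_root_in01 f r b -> a < b -> False.
  move=> [/andP[a0 a1] aE] [/andP[b0 b1] bE] ab.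
  have [_ _ _ cv] := fP a b (ltW a0) (ltW ab) (ltW b1).
  have /andP[r0 r1] := r01.
  have := ler_wpM2l (ltW (_ : 0 < 1 - r)) cv; rewrite subr_gt0 => /(_ r1).
  have -> : (1 - r) * ((1 - a) * f b) = (1 - a) * b by rewrite [in RHS]bE; ring.
  have -> : (1 - r) * ((b - a) + (1 - b) * f a) =
      (1 - r) * (b - a) + (1 - b) * a.
    by rewrite [X in _ + (1 - b) * X]aE; ring.
  have : 0 < r * (b - a) by rewrite mulr_gt0// subr_gt0.
  lra.
move=> xP yP; have [xy|yx|//] := ltgtP x y.
  by have := H _ _ xP yP xy.
by have := H _ _ yP xP yx.
Qed.

End pgf_like.

(** * Abel means, and the chord condition for mixtures *)

Section abel.
Context (R : realType).

(** For [0 < r < 1] this is the expectation of [u] at an independent geometric time, which takes the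
    value [n] with probability [(1 - r) ^+ n * r]. *)
Definition abel (r : R) (u : nat -> R) : R :=
  fine (\sum_(0 <= n <oo) ((1 - r) ^+ n * r * u n)%:E)%E.

Variable r : R.
Hypothesis r01 : 0 < r < 1.
Implicit Types (u v : nat -> R) (M : R).

Let coef_ge0 n : 0 <= (1 - r) ^+ n * r.
Proof. by case/andP: r01 => r0 r1; rewrite mulr_ge0// ?exprn_ge0//; lra. Qed.

Let term_ge0 u M n : (forall n, 0 <= u n <= M) ->
  (0 <= ((1 - r) ^+ n * r * u n)%:E)%E.
Proof. by move=> uM; rewrite lee_fin mulr_ge0//; case/andP: (uM n). Qed.

Lemma abel_series_bound u M : (forall n, 0 <= u n <= M) ->
  (0 <= \sum_(0 <= n <oo) ((1 - r) ^+ n * r * u n)%:E <= M%:E)%E.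
Proof.
move=> uM; have t0 n := term_ge0 n uM.
have M0 : 0 <= M by case/andP: (uM 0%N) => /le_trans; exact.
rewrite nneseries_ge0//=.
apply: lime_le; first by apply: is_cvg_nneseries => n _ _; exact: t0.
apply: nearW => k; rewrite sumEFin lee_fin.
have [r0 r1] : 0 < r /\ r < 1 by apply/andP.
(* The first [k] weights sum to [1 - (1 - r) ^+ k]. *)
apply: (@le_trans _ _ (M * (1 - (1 - r) ^+ k))); last first.
  by rewrite ler_piMr// gerBl exprn_ge0// subr_ge0 ltW.
elim: k => [|k ih]; first by rewrite big_geq// expr0 subrr mulr0.
rewrite big_nat_recr//=; apply: (le_trans (lerD ih (lexx _))).
have /andP[_ ukM] := uM k.
rewrite exprS; have := ler_wpM2l (coef_ge0 k) ukM.
move: ((1 - r) ^+ k) => x; nra.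
Qed.

Lemma abelE u M : (forall n, 0 <= u n <= M) ->
  (abel r u)%:E = (\sum_(0 <= n <oo) ((1 - r) ^+ n * r * u n)%:E)%E.
Proof.
move=> uM; rewrite fineK//; have /andP[s0 sM] := abel_series_bound uM.
by rewrite ge0_fin_numE// (le_lt_trans sM)// ltry.
Qed.

Lemma abel_bound u M : (forall n, 0 <= u n <= M) -> 0 <= abel r u <= M.
Proof. by move=> uM; rewrite -!lee_fin (abelE uM) abel_series_bound. Qed.

Lemma abel_le u v M : (forall n, 0 <= u n) -> (forall n, u n <= v n) ->
  (forall n, v n <= M) -> abel r u <= abel r v.
Proof.
move=> u0 uv vM.
have uM n : 0 <= u n <= M by rewrite u0 (le_trans (uv n)).
have v0M n : 0 <= v n <= M by rewrite vM (le_trans (u0 n)).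
rewrite -lee_fin (abelE uM) (abelE v0M); apply: lee_nneseries => n _.
  by move=> _; exact: (term_ge0 n uM).
by rewrite lee_fin ler_wpM2l.
Qed.

(** The coefficients are non-negative so that the computation stays within series of non-negative
    extended reals. Identities with minus signs are therefore rearranged before they are
    averaged. *)
Lemma abel_linear u v (a b M M' : R) : 0 <= a -> 0 <= b ->
  (forall n, 0 <= u n <= M) -> (forall n, 0 <= v n <= M') ->
  abel r (fun n => a * u n + b * v n) = a * abel r u + b * abel r v.
Proof.
move=> a0 b0 uM vM.
have w n : 0 <= a * u n + b * v n <= a * M + b * M'.
  have /andP[u0 u1] := uM n; have /andP[v0 v1] := vM n.
  by rewrite addr_ge0 ?mulr_ge0//= lerD// ler_wpM2l.
apply: EFin_inj; rewrite EFinD !EFinM (abelE w) (abelE uM) (abelE vM).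
rewrite -!nneseriesZl; last 2 first.
- by move=> n _; exact: (term_ge0 n vM).
- by move=> n _; exact: (term_ge0 n uM).
rewrite -nneseriesD; last 2 first.
- by move=> n _ _; apply: mule_ge0; [rewrite lee_fin|exact: (term_ge0 n uM)].
- by move=> n _ _; apply: mule_ge0; [rewrite lee_fin|exact: (term_ge0 n vM)].
apply: eq_eseriesr => n _; rewrite -!EFinM -EFinD; congr (_%:E); ring.
Qed.

Lemma abel_recl u M : (forall n, 0 <= u n <= M) ->
  abel r u = r * u 0%N + (1 - r) * abel r (fun n => u n.+1).
Proof.
move=> uM; have [r0 r1] : 0 < r /\ r < 1 by apply/andP.
have uSM n : 0 <= u n.+1 <= M by exact: uM.
apply: EFin_inj; rewrite EFinD [((1 - r) * _)%:E]EFinM (abelE uM) (abelE uSM).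
rewrite nneseries_recl//; last by move=> n _; exact: (term_ge0 n uM).
rewrite expr0 mul1r; congr (_ + _)%E.
rewrite -(nneseries_addn 1); last by move=> n; exact: (term_ge0 n uM).
rewrite -nneseriesZl; last by move=> n _; exact: (term_ge0 n uSM).
by apply: eq_eseriesr => n _; rewrite -EFinM addn1 exprS -!mulrA.
Qed.

(** Each clause is averaged over [n]. In the chord clause the constant [b - a] turns into [b - a]
    times the mean of 1, which is at most [b - a]. *)
Lemma pgf_like_abel (F : nat -> R -> R) : (forall n, pgf_like (F n)) ->
  pgf_like (fun z => abel r (fun n => F n z)).
Proof.
move=> FP a b a0 ab b1; have b0 := le_trans a0 ab; have a1 := le_trans ab b1.
have Fb n : 0 <= F n b <= 1.
  by have [_ _ -> _] := FP n _ _ a0 ab b1; have [->] := FP n _ _ b0 (lexx b) b1.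
have Fa n : 0 <= F n a <= 1.
  by have [-> _ ->] := FP n _ _ a0 (lexx a) a1.
have one (n : nat) : 0 <= cst (1 : R) n <= 1 by rewrite /= ler01 lexx.
have /andP[Aa0 _] := abel_bound Fa.
have /andP[_ Ab1] := abel_bound Fb.
split => //.
  apply: (@abel_le _ _ 1) => n; [by case/andP: (Fa n)| |by case/andP: (Fb n)].
  by have [] := FP n _ _ a0 ab b1.
(* The null summand only brings the left-hand side into the two-term form of [abel_linear]. *)
have -> : (1 - a) * abel r (F ^~ b) =
    abel r (fun n => (1 - a) * F n b + 0 * F n b).
  by rewrite (abel_linear _ _ Fb Fb) ?subr_ge0//; ring.
apply: (@le_trans _ _ (abel r (fun n => (b - a) * cst 1 n + (1 - b) * F n a))).
  apply: (@abel_le _ _ ((b - a) * 1 + (1 - b) * 1)) => n.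
  - by rewrite mul0r addr0 mulr_ge0 ?subr_ge0//; case/andP: (Fb n).
  - by have [_ _ _] := FP n _ _ a0 ab b1; rewrite mul0r addr0 /= mulr1.
  - by rewrite lerD// ler_wpM2l ?subr_ge0//; case/andP: (Fa n).
rewrite (abel_linear _ _ one Fa) ?subr_ge0// lerD2r.
by rewrite ler_piMr ?subr_ge0//; case/andP: (abel_bound one).
Qed.

End abel.

(** The clauses hold pointwise for [z ^+ X w] by [pgf_like_exprn] and are integrated; the constant
    [b - a] integrates to itself since [P] has mass 1. *)
Lemma pgf_like_pgf (d : measure_display) (T : measurableType d) (R : realType)
    (P : probability T R) (X : {mfun T >-> nat}) : pgf_like (pgf P X).
Proof.
move=> a b a0 ab b1; have b0 := le_trans a0 ab; have a1 := le_trans ab b1.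
have ma : measurable_fun setT (fun w => (a ^+ X w)%:E).
  exact: measurable_exprn_comp.
have mb : measurable_fun setT (fun w => (b ^+ X w)%:E).
  exact: measurable_exprn_comp.
have a01 : 0 <= a <= 1 by apply/andP.
have b01 : 0 <= b <= 1 by apply/andP.
have pa0 w : (0 <= (a ^+ X w)%:E)%E by rewrite lee_fin exprn_ge0.
have pb0 w : (0 <= (b ^+ X w)%:E)%E by rewrite lee_fin exprn_ge0.
have qa : 0 <= 1 - a by rewrite subr_ge0.
have qb : 0 <= 1 - b by rewrite subr_ge0.
have ba : 0 <= b - a by rewrite subr_ge0.
split; rewrite -lee_fin ?EFinD ?EFinM ?pgfE//.
- by apply: integral_ge0.
- apply: ge0_le_integral => // w _; rewrite lee_fin.
  by have [] := pgf_like_exprn (X w) a0 ab b1.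
- by case/andP: (pgf_bound P (@measurable_funPT _ _ _ _ X) b01).
- rewrite -EFinD -!ge0_integralZl_EFin//.
  have -> : (b - a)%:E = (\int[P]_w (cst (b - a)%:E w))%E.
    by rewrite integral_cst//= [P _]probability_setT mule1.
  rewrite -ge0_integralD//; last 2 first.
  + by move=> w _; rewrite mule_ge0// lee_fin.
  + exact: measurable_funeM.
  apply: ge0_le_integral => //.
  + by move=> w _; rewrite mule_ge0// lee_fin.
  + exact: measurable_funeM.
  + by apply: emeasurable_funD => //; exact: measurable_funeM.
  + move=> w _; rewrite -!EFinM -EFinD lee_fin.
    by have [] := pgf_like_exprn (X w) a0 ab b1.
Qed.

(** * The queue recursion and its double transform *)

(** Subtraction on [nat] is truncated, so [Q w - 1] is the positive part. As a function of [Q] it is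
    still independent of [N], so the generating function factorizes, and the factor [z] lets
    [pgf_pred_rec] remove the truncation. *)
Lemma queue_pgf_rec (d : measure_display) (T : measurableType d) (R : realType)
    (P : probability T R) (Q Q' N : {mfun T >-> nat}) (z : R) :
  independent P Q N -> eq_dist P Q' (fun w => (Q w - 1 + N w)%N) ->
  0 <= z <= 1 ->
  z * pgf P Q' z =
  pgf P N z * (pgf P Q z - (1 - z) * fine (P (Q @^-1` [set 0%N]))).
Proof.
move=> QN QE z01.
have mQ1 : measurable_fun setT (fun w => (Q w - 1)%N).
  by apply: (measurableT_comp (f := fun k : nat => (k - 1)%N)).
pose Q1 : {mfun T >-> nat} := mfun_Sub (mem_set mQ1).
have mD : measurable_fun setT (fun w => (Q1 w + N w)%N).
  exact: measurable_fun_addn.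
have Q1N : independent P Q1 N.
  by move=> A B mA mB; exact: (QN ((fun k => (k - 1)%N) @^-1` A) B).
rewrite (@eq_dist_pgf _ _ _ P Q' (mfun_Sub (mem_set mD)) z)//.
by rewrite (independent_pgfD Q1N z01) -pgf_pred_rec//; ring.
Qed.

Unset Implicit Arguments.

Theorem theorem5p1 (d : measure_display) (T : measurableType d) (R : realType)
  (P : probability T R)
  (S Lambda : {RV P >-> R})
  (Sn Ln : nat -> {RV P >-> R})
  (N Q : nat -> {RV P >-> nat})
  (S_ge0 : forall w, 0 <= S w)
  (Lambda_ge0 : forall w, 0 <= Lambda w)
  (Sn_copies : forall n, eq_dist P (Sn n.+1) S)
  (Ln_copies : forall n, eq_dist P (Ln n.+1) Lambda)
  (Sn_Ln_indep : mutually_independent P (fun i : nat + nat =>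
     match i with inl n => Sn n.+1 : T -> R | inr n => Ln n.+1 : T -> R end))
  (N_poisson : forall n, poisson_given P (Sn n.+1) (Ln n.+1) (N n.+1))
  (Q0_N_indep : mutually_independent P (fun i : option nat =>
     match i with None => Q 0%N : T -> nat | Some n => N n.+1 : T -> nat end))
  (Q_N_indep : forall n, independent P (Q n) (N n.+1))
  (Q_rec : forall n, eq_dist P (Q n.+1) (fun w => (Q n w - 1 + N n.+1 w)%N)) :
  let nu := arrivals_pgf P S Lambda in
  let kappa0 := pgf P (Q 0%N) in
  let K := double_transform P (fun n => Q n : T -> nat) in
  (forall n (z : R), 0 < z < 1 -> pgf P (N n.+1) z = nu z) /\
  forall r : R, 0 < r < 1 ->
    exists z0 : R,
      [/\ is_root_in01 nu r z0,
          (forall z, is_root_in01 nu r z -> z = z0),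
          (forall z, 0 < z < 1 -> z != z0 ->
             K r z = (transform_rhs nu kappa0 r z0 z)%:E)
        & (transform_rhs nu kappa0 r z0 z)%:E @[z --> z0^'] --> K r z0].
Proof.
move=> nu kappa0 K.
have Ln_Sn_indep n : independent P (Ln n.+1) (Sn n.+1).
  move=> A B mA mB.
  (* Pairwise independence is mutual independence for this two-element family. *)
  have := Sn_Ln_indep [:: inr n; inl n]
    (fun i => match i with inl _ => B | inr _ => A end) isT.
  rewrite !big_cons big_nil mule1 => /(_ _) <-; last by case.
  congr (P _); apply/seteqP; split => w /=.
    by move=> [wA wB] i /=; rewrite !inE => /orP[] /eqP ->.
  by move=> h; split; [apply: (h (inr n))|apply: (h (inl n))];
    rewrite /= !inE eqxx ?orbT.
have nuE n z : 0 <= z <= 1 -> pgf P (N n.+1) z = nu z.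
  exact: (pgf_arrivals S_ge0 Lambda_ge0 (Sn_copies n) (Ln_copies n)
    (Ln_Sn_indep n) (N_poisson n)).
split=> [n z /andP[z0 z1]|r r01]; first by rewrite nuE// !ltW.
have [r0 r1] : 0 < r /\ r < 1 by apply/andP.
(* [G] is the generating function of an actual variable and equals [nu] on [[0, 1]], so the root
   lemmas apply to it and carry over to [nu]. *)
pose G := pgf P (N 1%N).
have GP : pgf_like G by exact: pgf_like_pgf.
have rootE z : is_root_in01 nu r z <-> is_root_in01 G r z.
  split=> -[z01 zE]; split=> //; rewrite [LHS]zE.
    by rewrite /G nuE//; case/andP: z01 => z0 z1; rewrite !ltW.
  by rewrite -(nuE 0%N)//; case/andP: z01 => z0 z1; rewrite !ltW.
pose k z := abel r (fun n => pgf P (Q n) z).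
pose p n := fine (P (Q n @^-1` [set 0%N])).
have Qb z : 0 <= z <= 1 -> forall n, 0 <= pgf P (Q n) z <= 1.
  move=> /andP[z0 z1] n.
  by have [-> _ ->] := @pgf_like_pgf _ _ _ P (Q n) z z z0 (lexx z) z1.
have pb n : 0 <= p n <= 1.
  have mQ0 : measurable (Q n @^-1` [set 0%N]).
    by rewrite -[X in measurable X]setTI; exact: measurable_funP.
  by rewrite -!lee_fin fineK ?fin_num_measure// measure_ge0 probability_le1.
have KE z : 0 < z < 1 -> K r z = (k z)%:E.
  by move=> /andP[z0 z1]; rewrite (abelE r01 (Qb z _))// !ltW.
(* The identity is stated without division so that it can also be evaluated at the root. *)
have kE z : 0 < z < 1 ->
    (z - (1 - r) * nu z) * k z =
    r * z * kappa0 z - (1 - r) * (1 - z) * nu z * abel r p.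
  move=> /andP[z0 z1]; have z01 : 0 <= z <= 1 by rewrite !ltW.
  have Qz := Qb z z01.
  have QSz n : 0 <= pgf P (Q n.+1) z <= 1 by exact: Qz.
  have nu0 : 0 <= nu z.
    by rewrite -(nuE 0%N)//; have [] := GP z z (ltW z0) (lexx z) (ltW z1).
  have kS : k z = _ := abel_recl r01 Qz.
  (* This is the average of the queue recursion with the subtracted term moved to the left, which
     keeps all coefficients non-negative; [0 * k z] is padding. *)
  have : z * abel r (fun n => pgf P (Q n.+1) z) + nu z * (1 - z) * abel r p =
         nu z * k z + 0 * k z.
    rewrite -(abel_linear r01 (ltW z0) _ QSz pb); last first.
      by rewrite mulr_ge0// subr_ge0 ltW.
    rewrite -(abel_linear r01 _ _ Qz Qz)//.
    congr abel; apply/funext => n.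
    by rewrite (queue_pgf_rec (Q_N_indep n) (Q_rec n) z01) nuE// /p; ring.
  move=> /(canRL (addrK _)) zA.
  rewrite mulrBl {1}kS mulrDr [z * ((1 - r) * _)]mulrCA zA /kappa0; ring.
have [z0 z0G] :=
  pgf_like_root_exists GP (mixed_poisson_pgf0_gt0 (N_poisson 0%N)) r01.
have z0nu : is_root_in01 nu r z0 by exact/rootE.
have z0u z : is_root_in01 nu r z -> z = z0.
  by move=> /rootE zG; exact: (pgf_like_root_unique GP r01 zG z0G).
have [z001 z0E] := z0nu.
have PiE : abel r p = r * kappa0 z0 / (1 - z0).
  (* At [z0] the left factor vanishes and [(1 - r) * nu z0] is [z0], which leaves [r * z0 * kappa0
     z0 = z0 * (1 - z0) * abel r p]. *)
  have := kE z0 z001; rewrite -z0E subrr mul0r.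
  have /andP[z00 z01] := z001.
  move=> /eqP; rewrite eq_sym subr_eq0 => /eqP e.
  have z0n0 : z0 != 0 by rewrite gt_eqF.
  have z0n1 : 1 - z0 != 0 by rewrite subr_eq0 gt_eqF.
  apply: (mulfI (mulf_neq0 z0n0 z0n1)).
  transitivity (r * z0 * kappa0 z0); last by field.
  by rewrite e [X in X * (1 - z0) * _]z0E; ring.
have KrhsE z : 0 < z < 1 -> z != z0 ->
    K r z = (transform_rhs nu kappa0 r z0 z)%:E.
  move=> z01 zz0; rewrite KE//; congr (_%:E).
  have D : z - (1 - r) * nu z != 0.
    apply: contra zz0; rewrite subr_eq0 => /eqP zE.
    by apply/eqP/z0u; split.
  apply: (mulfI D); rewrite kE// PiE /transform_rhs.
  by field; rewrite D/= subr_eq0 gt_eqF//; case/andP: z001.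
exists z0; split => //.
rewrite KE//.
(* The limit of the right-hand side comes from continuity of [k], an Abel mean of generating
   functions: both agree at the points of [(0, 1)] other than [z0], hence on a punctured
   neighbourhood of [z0]. *)
have : (k z)%:E @[z --> z0^'] --> (k z0)%:E.
  apply: cvg_EFin; first by apply: nearW.
  have kP : pgf_like k by apply: pgf_like_abel => // n; exact: pgf_like_pgf.
  exact/continuous_withinNx/pgf_like_continuous.
apply: cvg_trans; apply: near_eq_cvg.
near=> z; have z01 : 0 < z < 1.
  suff : z \in `]0, 1[ by rewrite in_itv.
  near: z; apply: nbhs_dnbhs; apply: near_in_itvoo.
  by rewrite in_itv.
rewrite -KrhsE ?KE//.
by near: z; exact: nbhs_dnbhs_neq.
Unshelve. all: by end_near. Qed.
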